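(* Let $s \in \mathbb{R}$ with $s \notin \mathbb{Q}$, and let $\mu^{\pm} = \mu^{\pm}(s)$ be its upper and lower approximation exponents. Then $$\limsup_{t \rightarrow \infty} \frac{\log \alpha_1(h_t \Lambda_s)}{\log t} = 1 - \frac{1}{\mu^+},$$ and $$\limsup_{t \rightarrow \infty} \frac{\log \alpha_1(h_{-t} \Lambda_s)}{\log t} = 1 - \frac{1}{\mu^-}.$$
   Context: For $t, s \in \mathbb{R}$, $$h_t = \begin{pmatrix} 1 & t \\ 0 & 1 \end{pmatrix}, \qquad \Lambda_s = \begin{pmatrix} 1 & 0 \\ s & 1 \end{pmatrix}\mathbb{Z}^2,$$ so $\Lambda_s$ is a unimodular lattice in $\mathbb{R}^2$; matrices act on lattices by $g\Lambda = \{gv : v\in\Lambda\}$. For a lattice $\Lambda \subset \mathbb{R}^2$, $\alpha_1(\Lambda) = \sup_{0 \neq v \in \Lambda} \frac{1}{\|v\|}$ with $\|\cdot\|$ the Euclidean norm. The upper and lower approximation exponents of $s$ are $$\mu^{+}(s) = \sup\left\{\nu \in \mathbb{R} : 0 < \tfrac{p}{q} - s < \tfrac{1}{q^\nu} \text{ has infinitely many solutions } \tfrac{p}{q} \in \mathbb{Q}\right\},$$ $$\mu^{-}(s) = \sup\left\{\nu \in \mathbb{R} : 0 < s - \tfrac{p}{q} < \tfrac{1}{q^\nu} \text{ has infinitely many solutions } \tfrac{p}{q} \in \mathbb{Q}\right\},$$ where rationals $p/q$ are written with $q > 0$. The value $\infty$ is allowed for $\mu^{\pm}$, with the convention $1/\infty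 = 0$. *)

(* Defs.v *)
From mathcomp Require Import all_boot all_order all_algebra.
From mathcomp Require Import all_classical all_reals all_analysis.

Set Implicit Arguments.
Unset Strict Implicit.
Unset Printing Implicit Defensive.

Import Order.TTheory GRing.Theory Num.Theory.
Import numFieldNormedType.Exports.

Local Open Scope classical_set_scope.
Local Open Scope ring_scope.

Section Lattices.
Variable R : realType.
Implicit Types (s t : R) (v : 'cV[R]_2) (L : set 'cV[R]_2).

Definition h t : 'M[R]_2 := block_mx 1%:M t%:M 0 1%:M :> 'M[R]_(1 + 1).

Definition Z2 : set 'cV[R]_2 :=
  [set map_mx intr m | m in [set: 'cV[int]_2]].

Definition act (g : 'M[R]_2) L : set 'cV[R]_2 := [set g *m v | v in L].

Definition Lambda s : set 'cV[R]_2 :=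
  act (block_mx 1%:M 0 s%:M 1%:M : 'M[R]_(1 + 1)) Z2.

(* The library norm `|v| on matrices is the sup norm, hence this definition. *)
Definition euclidean_norm v : R := Num.sqrt (\sum_(i < 2) v i 0 ^+ 2).

(* The set below is bounded above when L is a lattice, L being discrete; the
   real-valued sup is then the actual supremum. *)
Definition alpha1 L : R :=
  sup [set (euclidean_norm v)^-1 | v in [set v | L v /\ v <> 0]].

End Lattices.

Section ApproximationExponents.
Variable R : realType.
Implicit Types s nu : R.

(* The solutions are counted as rational numbers r, not as pairs (p, q); the
   fraction p / q representing r need not be in lowest terms. *)
Definition upper_solutions s nu : set rat :=
  [set r | exists (p : int) (q : nat),
    [/\ (0 < q)%N, r = p%:~R / q%:R &
        0 < p%:~R / q%:R - s < 1 / q%:R `^ nu]].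

Definition lower_solutions s nu : set rat :=
  [set r | exists (p : int) (q : nat),
    [/\ (0 < q)%N, r = p%:~R / q%:R &
        0 < s - p%:~R / q%:R < 1 / q%:R `^ nu]].

Definition mu_plus s : \bar R :=
  ereal_sup [set nu%:E | nu in [set nu | infinite_set (upper_solutions s nu)]].

Definition mu_minus s : \bar R :=
  ereal_sup [set nu%:E | nu in [set nu | infinite_set (lower_solutions s nu)]].

End ApproximationExponents.

(* Main.v *)
Require Import Defs.
From mathcomp Require Import all_boot all_order all_algebra.
From mathcomp Require Import all_classical all_reals all_analysis.
From mathcomp Require Import ring lra.

Set Implicit Arguments.
Unset Strict Implicit.
Unset Printing Implicit Defensive.

Import Order.TTheory GRing.Theory Num.Theory.
Import numFieldNormedType.Exports.

Local Open Scope classical_set_scope.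
Local Open Scope ring_scope.

(** The nonzero vectors of h_t Lambda_s are (m + t y, y) with y = s m + n and
    m, n integers.  Up to sign m >= 0, and for t >= 1 such a vector has norm
    at least 1 unless m = q > 0 and y = - d < 0.  Then, with p = - n, the
    number d = p - s q is q times the error p / q - s of an approximation of s
    from above, so short vectors come from good upper approximations.  The
    link is quantitative in both directions.

    - If infinitely many p / q satisfy p / q - s < 1 / q ^ nu with nu >= 1,
      take t = q / d, for which the vector is (0, - d).  Then alpha_1 >= 1 / d
      and log t = log q + log (1 / d), where log (1 / d) > (nu - 1) log q, so
      log alpha_1 / log t >= 1 - 1 / nu (limsup_growth_ge).
    - If only finitely many do, then p / q - s >= c / q ^ nu for some c > 0 and
      all p / q > s.  A vector of norm N < 1 has d <= N and
      q <= N + t d <= 2 t N, so N >= d >= c q ^ (1 - nu) >= c (2 t N) ^ (1 - nu),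
      that is, N >= C t ^ (1 / nu - 1), whence the limsup is at most 1 - 1 / nu
      (limsup_growth_le).

    As q >= 1, the bound q <= 2 t N alone gives N >= 1 / (2 t), so the limsup
    is at most 1; this covers an infinite exponent.  Since mu^+ >= 1
    (infinite_upper_solutions1), letting nu tend to mu^+ from both sides gives
    the first formula (limsup_growthE).  The reflection of the second
    coordinate carries h_(-t) Lambda_s to h_t Lambda_(-s) and exchanges lower
    approximations of s with upper approximations of - s, which reduces the
    second formula to the first. *)

(** * Limits superior at infinity *)

Section LimsupAtInfinity.
Context {R : realType}.
Implicit Types (f : R -> \bar R) (a : R).

Lemma limf_esup_pinfty_le f a :
  (forall e : R, 0 < e -> \forall t \near +oo, (f t <= (a + e)%:E)%E) ->
  (limf_esup f +oo%R <= a%:E)%E.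
Proof.
move=> fa; apply/lee_addgt0Pr => e e0; rewrite limf_esupE -EFinD.
apply: (@le_trans _ _ (ereal_sup (f @` [set t | (f t <= (a + e)%:E)%E]))).
  by apply: ereal_inf_lbound; exists [set t | (f t <= (a + e)%:E)%E] => //; exact: fa.
by apply: ge_ereal_sup => _ [t /= ft <-].
Qed.

Lemma limf_esup_pinfty_ge f a :
  (forall M : R, exists2 t, M < t & (a%:E <= f t)%E) ->
  (a%:E <= limf_esup f +oo%R)%E.
Proof.
move=> fa; rewrite limf_esupE; apply: le_ereal_inf_tmp => _ [V [M [_ MV]] <-].
have [t Mt aft] := fa M.
by apply: le_trans aft _; apply: ereal_sup_ubound; exists t => //; exact: MV.
Qed.

(** C / ln t tends to 0; constant factors in a bound on A are absorbed by C. *)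
Lemma limf_esup_ln_ratio_le (A : R -> R) a C :
  (forall t, 1 <= t -> ln (A t) <= a * ln t + C) ->
  (limf_esup (fun t => (ln (A t) / ln t)%:E) +oo%R <= a%:E)%E.
Proof.
move=> lnA; apply: limf_esup_pinfty_le => e e0.
(* beyond this point ln t is positive and C <= e * ln t *)
have := @nbhs_pinfty_ge R (expR (Num.max 1 (C / e))) (num_real _).
apply: filterS => t tge; rewrite lee_fin.
have t0 : 0 < t by apply: lt_le_trans tge; exact: expR_gt0.
have lnt : Num.max 1 (C / e) <= ln t.
  by rewrite -[leLHS]expRK ler_ln ?posrE ?expR_gt0.
move: lnt; rewrite ge_max ler_pdivrMr// => /andP[lnt1 Clnt].
have lnt0 : 0 < ln t by exact: lt_le_trans lnt1.
rewrite ler_pdivrMr//.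
have t1 : 1 <= t.
  by apply: le_trans tge; rewrite -[leLHS]expR0 ler_expR le_max ler01.
by have := lnA _ t1; lra.
Qed.

End LimsupAtInfinity.

(** * Norms of the vectors of the sheared lattice *)

Section LatticeNorms.
Context {R : realType}.
Implicit Types (s t : R) (x : int * int).

(** Norm of the vector of h_t Lambda_s with integral coordinates x.  Indexing the
    lattice by pairs of integers turns statements on alpha1 into real
    inequalities. *)
Definition lattice_norm s t x : R :=
  Num.sqrt ((x.1%:~R + t * (s * x.1%:~R + x.2%:~R)) ^+ 2
            + (s * x.1%:~R + x.2%:~R) ^+ 2).

(** The entries of the block matrices in h and Lambda are indexed by 'I_(1 + 1),
    whereas sums over 'I_2 produce other terms for the same indices. *)
Lemma mul_block_mx_ord2 (a b c d : R) (v : 'cV[R]_2) :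
  let w : 'cV[R]_2 :=
    (block_mx a%:M b%:M c%:M d%:M : 'M[R]_(1 + 1)) *m v in
  w 0 0 = a * v 0 0 + b * v 1 0 /\ w 1 0 = c * v 0 0 + d * v 1 0.
Proof.
have l1 : lift ord0 ord0 = 1 :> 'I_2 by exact: val_inj.
rewrite /= ![(_ *m v) _ _]mxE !big_ord_recl !big_ord0 !addr0 /= !l1.
set B := block_mx _ _ _ _.
have BE i i' j j' : val i = val i' -> val j = val j' -> B i j = B i' j'.
  by move=> ii' jj'; congr (B _ _); exact: val_inj.
rewrite -(BE (lshift 1 0) 0 (lshift 1 0) ord0)// -(BE (lshift 1 0) 0 (rshift 1 0) 1)//.
rewrite -(BE (rshift 1 0) 1 (lshift 1 0) ord0)// -(BE (rshift 1 0) 1 (rshift 1 0) 1)//.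
rewrite /B block_mxEul block_mxEur block_mxEdl block_mxEdr.
by rewrite !mxE !eqxx !mulr1n.
Qed.

Lemma lattice_vector_norm s t (m : 'cV[int]_2) :
  euclidean_norm (h t *m
    ((block_mx 1%:M 0 s%:M 1%:M : 'M[R]_(1 + 1)) *m map_mx intr m)) =
  lattice_norm s t (m 0 0, m 1 0).
Proof.
rewrite /euclidean_norm /lattice_norm /h; congr Num.sqrt.
rewrite !big_ord_recl big_ord0 addr0 /=.
have -> : lift ord0 ord0 = 1 :> 'I_2 by exact: val_inj.
have -> : (0 : 'M[R]_1) = 0%:M by rewrite raddf0.
have [-> ->] := mul_block_mx_ord2 1 t 0 1
  ((block_mx 1%:M 0%:M s%:M 1%:M : 'M[R]_(1 + 1)) *m map_mx intr m).
have [-> ->] := mul_block_mx_ord2 1 0 s 1 (map_mx intr m).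
by rewrite !mxE !mul1r !mul0r !addr0 !add0r.
Qed.

Lemma euclidean_norm_eq0 (v : 'cV[R]_2) : (euclidean_norm v == 0) = (v == 0).
Proof.
rewrite /euclidean_norm sqrtr_eq0 !big_ord_recl big_ord0 addr0.
apply/idP/eqP => [le0|->]; last by rewrite !mxE !expr0n addr0.
have := sqr_ge0 (v 0 0); have := sqr_ge0 (v (lift ord0 ord0) 0) => p1 p0.
apply/colP => i; rewrite mxE; apply/eqP; rewrite -sqrf_eq0.
case: (unliftP ord0 i) => [j ->|->].
  by rewrite (ord1 j) eq_le p1 andbT; lra.
by rewrite eq_le p0 andbT; lra.
Qed.

Lemma alpha1_lattice_norm s t :
  alpha1 (act (h t) (Lambda s)) =
  sup [set (lattice_norm s t x)^-1 | x in [set x | lattice_norm s t x != 0]].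
Proof.
rewrite /alpha1; congr sup; apply/seteqP; split => [_ [v [hv v0] <-]|_ [x x0 <-]].
  case: hv v0 => _ [_ [m _ <-] <-] <- /eqP; rewrite -euclidean_norm_eq0.
  rewrite lattice_vector_norm => x0.
  by exists (m 0 0, m 1 0).
pose m : 'cV[int]_2 := \col_i (if i == 0 then x.1 else x.2).
have nm : lattice_norm s t x = lattice_norm s t (m 0 0, m 1 0).
  by rewrite !mxE /=; case: x {x0 m}.
exists (h t *m ((block_mx 1%:M 0 s%:M 1%:M : 'M[R]_(1 + 1)) *m map_mx intr m)).
  split; last by apply/eqP; rewrite -euclidean_norm_eq0 lattice_vector_norm -nm.
  by do 2!(eexists; last by []); exists m.
by rewrite lattice_vector_norm -nm.
Qed.

Lemma lattice_norm_opp s t m n :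
  lattice_norm s t (- m, - n) = lattice_norm s t (m, n).
Proof. by rewrite /lattice_norm /= !rmorphN /=; congr Num.sqrt; ring. Qed.

Lemma lattice_norm_reflect s t m n :
  lattice_norm s (- t) (m, n) = lattice_norm (- s) t (m, - n).
Proof. by rewrite /lattice_norm /= !rmorphN /=; congr Num.sqrt; ring. Qed.

(** The reflection of the second coordinate is an isometry that maps
    h_(-t) Lambda_s onto h_t Lambda_(-s). *)
Lemma alpha1_reflect s t :
  alpha1 (act (h (- t)) (Lambda s)) = alpha1 (act (h t) (Lambda (- s))).
Proof.
rewrite !alpha1_lattice_norm; congr sup.
apply/seteqP; split => _ [[m n] /= x0 <-]; exists (m, - n) => //=;
  by rewrite ?lattice_norm_reflect ?opprK// -lattice_norm_reflect.
Qed.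

Lemma lattice_norm_ge0 s t x : 0 <= lattice_norm s t x.
Proof. exact: sqrtr_ge0. Qed.

Lemma lattice_norm_ge s t m n (y := s * m%:~R + n%:~R) :
  `|m%:~R + t * y| <= lattice_norm s t (m, n) /\ `|y| <= lattice_norm s t (m, n).
Proof.
by split; rewrite -sqrtr_sqr /lattice_norm /= -/y ler_wsqrtr// ?lerDl ?lerDr sqr_ge0.
Qed.

(** Write the vector as (m + t y, y) with m >= 0.  If m = 0 then y is an integer,
    and if m > 0 and y >= 0 then the first coordinate is at least m; both give norm at
    least 1.  Otherwise m = q and y = - (p - s q) with p - s q > 0, and the first
    coordinate q - t (p - s q) being at most the norm bounds q. *)
Lemma short_vector_approx s t x : 1 <= t -> lattice_norm s t x != 0 ->
  1 <= lattice_norm s t x \/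
  exists (p : int) (q : nat), [/\ (0 < q)%N, 0 < p%:~R - s * q%:R,
    p%:~R - s * q%:R <= lattice_norm s t x & q%:R <= 2 * t * lattice_norm s t x].
Proof.
move=> t1; case: x => m n; wlog m0 : m n / 0 <= m => [hw|].
  have [|/ltW m0] := leP 0 m; first exact: hw.
  by rewrite -(lattice_norm_opp s t m n); apply: hw; rewrite oppr_ge0.
have intr_ge1 (k : int) : k != 0 -> 1 <= `|k%:~R| :> R.
  by move=> k0; rewrite -intr_norm ler1z -gtz0_ge1 normr_gt0.
case: m m0 => // q _ N0.
have [] := lattice_norm_ge s t q n; set N := lattice_norm _ _ _ => Nx Ny.
have [q0|q0] := eqVneq q 0%N.
  left; move: Ny N0; rewrite /N q0 /= mulr0 add0r.
  have [->|n0 Ny _] := eqVneq n 0.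
    by rewrite /lattice_norm /= !(mulr0, addr0, expr0n) sqrtr0 eqxx.
  by apply: le_trans Ny; exact: intr_ge1.
have q1 : (1 : R) <= q%:R by rewrite ler1n lt0n.
move: Nx Ny; rewrite -pmulrn; set y := s * q%:R + n%:~R => Nx Ny.
have [y0|y0] := leP 0 y.
  left; apply: le_trans Nx; apply: le_trans (ler_norm _).
  by rewrite (le_trans q1)// lerDl mulr_ge0// (le_trans ler01).
right; exists (- n), q; rewrite lt0n q0 rmorphN /=.
have -> : - n%:~R - s * q%:R = - y by rewrite /y; ring.
have {}Ny : - y <= N by apply: le_trans Ny; rewrite -normrN ler_norm.
rewrite oppr_gt0 y0; split => //.
have {}Nx : q%:R + t * y <= N by exact: le_trans (ler_norm _) Nx.
by nra.
Qed.

(** This uniform bound makes the supremum in alpha1 a genuine one; it also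
    gives the estimate for an infinite exponent. *)
Lemma inv_lattice_norm_le s t x : 1 <= t -> lattice_norm s t x != 0 ->
  (lattice_norm s t x)^-1 <= 2 * t.
Proof.
move=> t1 x0; have N0 : 0 < lattice_norm s t x by rewrite lt_def x0 lattice_norm_ge0.
rewrite -[_^-1]mul1r ler_pdivrMr//.
case: (short_vector_approx t1 x0) => [N1|[p [q [q0 _ _ qN]]]]; first by nra.
by apply: le_trans qN; rewrite ler1n.
Qed.

Lemma lattice_norm_01_neq0 s t : lattice_norm s t (0, 1) != 0.
Proof.
rewrite lt0r_neq0//; apply: lt_le_trans (lattice_norm_ge s t 0 1).2.
by rewrite mulr0 add0r normr1.
Qed.

Lemma alpha1_ge s t x : 1 <= t -> lattice_norm s t x != 0 ->
  (lattice_norm s t x)^-1 <= alpha1 (act (h t) (Lambda s)).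
Proof.
move=> t1 x0; rewrite alpha1_lattice_norm; apply: ub_le_sup; last by exists x.
by exists (2 * t) => _ [y y0 <-]; exact: inv_lattice_norm_le.
Qed.

Lemma alpha1_gt0 s t : 1 <= t -> 0 < alpha1 (act (h t) (Lambda s)).
Proof.
move=> t1; apply: lt_le_trans (alpha1_ge t1 (lattice_norm_01_neq0 s t)).
by rewrite invr_gt0 lt_def lattice_norm_01_neq0 lattice_norm_ge0.
Qed.

Lemma ln_alpha1_le s t B : 1 <= t ->
  (forall x, lattice_norm s t x != 0 -> - ln (lattice_norm s t x) <= B) ->
  ln (alpha1 (act (h t) (Lambda s))) <= B.
Proof.
move=> t1 NB; rewrite -[leRHS]expRK ler_ln ?posrE ?expR_gt0 ?alpha1_gt0//.
rewrite alpha1_lattice_norm; apply: ge_sup.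
  by exists (lattice_norm s t (0, 1))^-1, (0, 1) => //; exact: lattice_norm_01_neq0.
move=> _ [x x0 <-].
have N0 : 0 < lattice_norm s t x by rewrite lt_def x0 lattice_norm_ge0.
by rewrite -[leLHS]lnK ?posrE ?invr_gt0// ler_expR lnV ?posrE// NB.
Qed.

End LatticeNorms.

(** * Approximation of an irrational number from above *)

Section UpperSolutions.
Context {R : realType}.
Implicit Types (s nu : R).

Lemma irrational_opp s : ~ rational s -> ~ rational (- s).
Proof.
move=> sQ /rationalP[p [q spq]]; apply: sQ; apply/rationalP; exists (- p), q.
by rewrite rmorphN /= mulNr -spq opprK.
Qed.

Lemma lower_solutionsE s nu :
  lower_solutions s nu = -%R @` upper_solutions (- s) nu.
Proof.
apply/seteqP; split => [r [p [q [q0 -> hp]]]|_ [_ [p [q [q0 -> hp]]] <-]].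
  exists (- p%:~R / q%:R); last by rewrite mulNr opprK.
  exists (- p), q; split => //; first by rewrite rmorphN.
  by rewrite rmorphN /= mulNr opprK addrC.
exists (- p), q; split => //; first by rewrite rmorphN /= mulNr.
by rewrite rmorphN /= mulNr opprK addrC -[s]opprK.
Qed.

Lemma mu_minusE s : mu_minus s = mu_plus (- s).
Proof.
rewrite /mu_minus /mu_plus; congr (ereal_sup (EFin @` _)).
apply/seteqP; split => nu /=; rewrite lower_solutionsE => inf fin; apply: inf.
  exact: finite_image.
have := finite_image -%R fin; rewrite image_comp.
by rewrite (eq_imagel (f' := id)) ?image_id// => r _ /=; rewrite opprK.
Qed.

Lemma seq_pos_lower_bound {T : eqType} (f : T -> R) (l : seq T) :
  (forall x, x \in l -> 0 < f x) ->
  exists2 m : R, 0 < m & forall x, x \in l -> m <= f x.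
Proof.
elim: l => [|y l IH] fl; first by exists 1.
have [x xl|m m0 fm] := IH; first by apply: fl; rewrite inE xl orbT.
exists (Num.min m (f y)) => [|x]; first by rewrite lt_min m0 fl// mem_head.
by rewrite inE ge_min => /predU1P[->|/fm ->//]; rewrite lexx orbT.
Qed.

(** Each rational solution has a fixed positive error, whichever fraction
    represents it, so finitely many solutions stay away from s. *)
Lemma finite_upper_solutions_gap s nu : finite_set (upper_solutions s nu) ->
  exists2 m : R, 0 < m & forall (p : int) (q : nat), (0 < q)%N ->
    0 < p%:~R / q%:R - s < 1 / q%:R `^ nu -> m <= p%:~R / q%:R - s.
Proof.
move=> /finite_seqP[l El].
have ratrE (p : int) (q : nat) : ratr (p%:~R / q%:R) = p%:~R / q%:R :> R.
  by rewrite fmorph_div /= ratr_int ratr_nat.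
have [r|m m0 lm] := @seq_pos_lower_bound _ (fun r : rat => ratr r - s) l.
  move=> rl; have : upper_solutions s nu r by rewrite El.
  by case=> p [q [_ -> /andP[+ _]]]; rewrite ratrE.
exists m => // p q q0 pq; rewrite -ratrE; apply: lm.
have : upper_solutions s nu (p%:~R / q%:R) by exists p, q.
by rewrite El.
Qed.

(** For nu >= 0 a solution lies within 1 of s, so a bound on the denominator
    leaves only finitely many numerators. *)
Lemma infinite_upper_solutions_den s nu (Q : nat) : 0 <= nu ->
  infinite_set (upper_solutions s nu) ->
  exists (p : int) (q : nat),
    (Q < q)%N /\ 0 < p%:~R / q%:R - s < 1 / q%:R `^ nu.
Proof.
move=> nu0 inf; apply: contrapT => none; apply: inf.
(* s q < p < s q + q, so p - floor (s q) is at most q *)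
pose F (x : nat * nat) : rat :=
  (Num.floor (s * x.1%:R) + x.2%:Z)%:~R / x.1%:R.
apply: (@sub_finite_set _ _ (F @` (`I_Q.+1 `*` `I_Q.+1))); last first.
  by apply: finite_image; apply: finite_setX; exact: finite_II.
move=> _ [p [q [q0 -> pq]]].
have qQ : (q <= Q)%N.
  by rewrite leqNgt; apply/negP => Qq; apply: none; exists p, q.
have q1 : (1 : R) <= q%:R by rewrite ler1n.
have qgt0 : (0 : R) < q%:R by exact: lt_le_trans q1.
move: pq => /andP[]; rewrite subr_gt0 ltr_pdivlMr// => sp pnu.
have : p%:~R / q%:R - s < 1.
  apply: lt_le_trans pnu _; rewrite div1r invf_le1 ?powR_gt0//.
  by rewrite -[leLHS](powRr0 q%:R) ler_powR.
rewrite ltrBlDr ltr_pdivrMr// mulrDl mul1r => ps.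
have fs := floor_le (s * q%:R).
have fs1 := floorD1_gt (s * q%:R).
set k := Num.floor _ in fs fs1.
have kp : k < p by rewrite -(ltr_int R); exact: le_lt_trans sp.
have pk : p < k + 1 + q%:Z.
  rewrite -(ltr_int R) rmorphD /= -pmulrn; apply: lt_le_trans ps _.
  by rewrite addrC lerD2r ltW.
have [i Ei] : exists i : nat, p = k + i%:Z.
  by exists `|p - k|%N; rewrite gez0_abs ?subr_ge0 ?ltW// [RHS]addrC subrK.
exists (q, i); last by rewrite /F /= -/k Ei.
split => //=; move: pk; rewrite Ei -addrA ltrD2l -PoszD ltz_nat add1n.
by move=> iq; apply: (leq_trans iq); rewrite ltnS.
Qed.

(** For every q the least integer p > s q has p / q - s < 1 / q, and these errors
    tend to 0, which finitely many solutions would not allow.  Irrationality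
    excludes p = s q + 1. *)
Lemma infinite_upper_solutions1 s : ~ rational s ->
  infinite_set (upper_solutions s 1).
Proof.
move=> sQ /finite_upper_solutions_gap[m m0 gap].
pose q := (Num.truncn m^-1).+1.
have mq : m^-1 < q%:R by exact: truncnS_gt.
have q0 : (0 : R) < q%:R by rewrite ltr0n.
pose p := Num.floor (s * q%:R) + 1.
have sp : s * q%:R < p%:~R by exact: floorD1_gt.
have ps : p%:~R <= s * q%:R + 1 by rewrite rmorphD /= lerD2r floor_le.
have pq : 0 < p%:~R / q%:R - s < 1 / q%:R `^ 1.
  rewrite powRr1 ?ler0n// subr_gt0 ltr_pdivlMr// sp /=.
  rewrite ltrBlDr -(ltr_pM2r q0) divfK ?lt0r_neq0// mulrDl divfK ?lt0r_neq0//.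
  rewrite lt_neqAle addrC ps andbT; apply/eqP => E.
  apply: sQ; apply/rationalP; exists (p - 1), q.
  by rewrite rmorphB /= E addrK mulfK// lt0r_neq0.
have := gap p q isT pq; apply/negP; rewrite -ltNge.
case/andP: pq => _ /lt_trans; apply.
by rewrite powRr1 ?ler0n// div1r invf_plt.
Qed.

End UpperSolutions.

(** * Growth of alpha_1 and the upper exponent *)

Section UpperExponent.
Context {R : realType}.
Implicit Types (s nu : R).

Let growth s t : \bar R := (ln (alpha1 (act (h t) (Lambda s))) / ln t)%:E.

Lemma limsup_growth_le1 s : (limf_esup (growth s) +oo%R <= 1%:E)%E.
Proof.
apply: (@limf_esup_ln_ratio_le _ _ _ (ln 2)) => t t1; rewrite mul1r.
have t0 : 0 < t by exact: lt_le_trans t1.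
apply: ln_alpha1_le => // x x0.
have N0 : 0 < lattice_norm s t x by rewrite lt_def x0 lattice_norm_ge0.
rewrite -lnV ?posrE// addrC -lnM ?posrE// ler_ln ?posrE ?invr_gt0 ?mulr_gt0//.
exact: inv_lattice_norm_le.
Qed.

(** The exponent nu gives p - s q >= c q ^ (1 - nu); combined with the bound
    q <= 2 t N for a vector of norm N < 1, this yields
    N ^ nu >= c (2 t) ^ (1 - nu).  All estimates are made on logarithms. *)
Lemma limsup_growth_le s nu : 1 <= nu ->
  finite_set (upper_solutions s nu) ->
  (limf_esup (growth s) +oo%R <= (1 - nu^-1)%:E)%E.
Proof.
move=> nu1 /finite_upper_solutions_gap[m m0 gap].
have nu0 : 0 < nu by exact: lt_le_trans nu1.
(* m handles the solutions and 1 the other fractions, as q ^ nu >= 1 *)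
pose c := Num.min 1 m.
have c0 : 0 < c by rewrite lt_min ltr01.
have c1 : c <= 1 by rewrite ge_min lexx.
have cm : c <= m by rewrite ge_min lexx orbT.
have lnc : ln c <= 0 by exact: ln_le0.
have ln2 : 0 <= ln 2 :> R by rewrite ln_ge0// ler1n.
have gapc (p : int) (q : nat) : (0 < q)%N -> 0 < p%:~R - s * q%:R ->
    ln c + (1 - nu) * ln q%:R <= ln (p%:~R - s * q%:R).
  move=> q0 d0; have qgt0 : (0 : R) < q%:R by rewrite ltr0n.
  have Ed : p%:~R - s * q%:R = q%:R * (p%:~R / q%:R - s).
    by rewrite mulrBr mulrCA divff ?lt0r_neq0// mulr1 mulrC.
  have e0 : 0 < p%:~R / q%:R - s by rewrite Ed pmulr_rgt0 in d0.
  have qnu : 1 <= q%:R `^ nu by rewrite -[leLHS](powRr0 q%:R) ler_powR ?ler1n// ltW.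
  have qnu0 : 0 < q%:R `^ nu :> R by exact: lt_le_trans qnu.
  have ce : c / q%:R `^ nu <= p%:~R / q%:R - s.
    have [enu|nue] := ltP (p%:~R / q%:R - s) (1 / q%:R `^ nu).
      apply: (@le_trans _ _ m); last by apply: gap => //; rewrite e0.
      by rewrite ler_pdivrMr//; nra.
    by apply: le_trans nue; rewrite ler_pM2r// invr_gt0.
  move: ce; rewrite -ler_ln ?posrE ?divr_gt0// lnM ?posrE ?invr_gt0// lnV ?posrE//.
  by rewrite ln_powR Ed lnM ?posrE//; lra.
apply: (@limf_esup_ln_ratio_le _ _ _ ((1 - nu^-1) * ln 2 - nu^-1 * ln c)) => t t1.
have t0 : 0 < t by exact: lt_le_trans t1.
have lnt : 0 <= ln t by exact: ln_ge0.
have nuV0 : 0 < nu^-1 by rewrite invr_gt0.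
have nuV1 : nu^-1 <= 1 by rewrite invf_le1.
apply: ln_alpha1_le => // x x0.
have N0 : 0 < lattice_norm s t x by rewrite lt_def x0 lattice_norm_ge0.
have [N1|[p [q [q0 d0 dN qN]]]] := short_vector_approx t1 x0.
  by have := ln_ge0 N1; nra.
have qgt0 : (0 : R) < q%:R by rewrite ltr0n.
move: dN qN; rewrite -ler_ln ?posrE// => dN.
rewrite -ler_ln ?posrE ?mulr_gt0// !lnM ?posrE ?mulr_gt0// => qN.
have := gapc p q q0 d0 => dc.
have : (1 - nu) * (ln 2 + ln t + ln (lattice_norm s t x)) <= (1 - nu) * ln q%:R.
  by rewrite ler_wnM2l// subr_le0.
move: (ln _) (ln (lattice_norm _ _ _)) dN dc => D N dN dc qN'.
(* the terms (1 - nu) * N cancel, leaving nu * N *)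
have main : - (nu * N) <= (nu - 1) * (ln 2 + ln t) - ln c by nra.
rewrite -(ler_pM2l nu0).
have -> : nu * ((1 - nu^-1) * ln t + ((1 - nu^-1) * ln 2 - nu^-1 * ln c)) =
  (nu - 1) * (ln 2 + ln t) - ln c by field; exact: lt0r_neq0.
by rewrite mulrN.
Qed.

(** The time t = q / (p - s q), the inverse of the error e = p / q - s, kills the
    first coordinate of the vector given by p / q, whose norm is then q e. *)
Lemma limsup_growth_ge s nu : 1 <= nu ->
  infinite_set (upper_solutions s nu) ->
  ((1 - nu^-1)%:E <= limf_esup (growth s) +oo%R)%E.
Proof.
move=> nu1 inf; have nu0 : 0 < nu by exact: lt_le_trans nu1.
apply: limf_esup_pinfty_ge => M.
have [p [q [Qq]]] := infinite_upper_solutions_den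
  (Num.truncn (Num.max M 1)).+1 (ltW nu0) inf.
have qM : Num.max M 1 < q%:R.
  by apply: lt_trans (truncnS_gt _) _; rewrite ltr_nat.
have q1 : 1 < q%:R :> R by apply: le_lt_trans qM; rewrite le_max lexx orbT.
have {}qM : M < q%:R by apply: le_lt_trans qM; rewrite le_max lexx.
have qgt0 : (0 : R) < q%:R by exact: lt_trans q1.
have qnu0 : 0 < q%:R `^ nu :> R by rewrite powR_gt0.
have lnq : 0 < ln (q%:R : R) by exact: ln_gt0.
set e := _ - s => /andP[e0 enu].
have lne : nu * ln q%:R <= - ln e.
  rewrite -ln_powR -lnV ?posrE// ler_ln ?posrE ?invr_gt0//.
  by rewrite -(invrK (_ `^ _)) lef_pV2 ?posrE ?invr_gt0// -div1r ltW.
have qeV : q%:R <= e^-1.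
  by rewrite -ler_ln ?posrE ?invr_gt0// lnV ?posrE//; nra.
have eV1 : 1 < e^-1 by exact: lt_le_trans qeV.
exists e^-1; first exact: lt_le_trans qeV.
rewrite lee_fin lnV ?posrE// ler_pdivlMr; last by nra.
have Ne : lattice_norm s e^-1 (q%:Z, - p) = q%:R * e.
  rewrite /lattice_norm /= rmorphN /= -pmulrn.
  have -> : s * q%:R - p%:~R = - (q%:R * e) by rewrite /e; field; exact: lt0r_neq0.
  rewrite (_ : q%:R + _ = 0); last by field; exact: lt0r_neq0.
  by rewrite expr0n add0r sqrrN sqrtr_sqr ger0_norm// mulr_ge0 ?ltW.
have qe0 : 0 < q%:R * e by exact: mulr_gt0.
have := @alpha1_ge _ s e^-1 (q%:Z, - p) (ltW eV1).
rewrite Ne => /(_ (lt0r_neq0 qe0)).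
rewrite -ler_ln ?posrE ?invr_gt0 ?alpha1_gt0 ?(ltW eV1)//.
apply: le_trans; rewrite lnV ?posrE// lnM ?posrE//.
have : ln q%:R <= nu^-1 * - ln e by rewrite ler_pdivlMl.
by rewrite mulrBl mul1r; lra.
Qed.

Lemma infinite_upper_solutions_lt s nu : (nu%:E < mu_plus s)%E ->
  exists2 nu', nu < nu' & infinite_set (upper_solutions s nu').
Proof. by move=> /ereal_sup_gt[_ [nu' inf <-]]; rewrite lte_fin; exists nu'. Qed.

Lemma finite_upper_solutions_gt s nu : (mu_plus s < nu%:E)%E ->
  finite_set (upper_solutions s nu).
Proof.
move=> munu; apply: contrapT => inf; move: munu; apply/negP; rewrite -leNgt.
by apply: ereal_sup_ubound; exists nu.
Qed.

(** The inverse exponent i = 1 / mu^+ is a real number even when mu^+ is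
    infinite, so the bounds for the exponents 1 / (i - e) and 1 / (i + e) squeeze
    the limsup.  When i - e <= 0 or i + e >= 1 the bounds 1 and 0 suffice. *)
Lemma limsup_growthE s : ~ rational s ->
  limf_esup (growth s) +oo = (1 - 1 / mu_plus s)%E.
Proof.
move=> sQ; have inf1 := infinite_upper_solutions1 sQ.
have mu1 : (1%:E <= mu_plus s)%E by apply: ereal_sup_ubound; exists 1.
have [i [i0 -> lti gti]] : exists i : R, [/\ 0 <= i,
    (1 - 1 / mu_plus s)%E = (1 - i)%:E,
    forall x, i < x -> ((x^-1)%:E < mu_plus s)%E &
    forall x, 0 < x < i -> (mu_plus s < (x^-1)%:E)%E].
  rewrite div1e; case: (mu_plus s) mu1 => [r||//]; rewrite ?lee_fin => r1.
    have r0 : 0 < r by exact: lt_le_trans r1.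
    exists r^-1; split; first by rewrite invr_ge0 ltW.
    - by rewrite inver gt_eqF.
    - move=> x rx; rewrite lte_fin invf_plt ?posrE//.
      by apply: lt_trans rx; rewrite invr_gt0.
    - by move=> x /andP[x0 xr]; rewrite lte_fin -[r]invrK ltf_pV2 ?posrE ?invr_gt0.
  exists 0; split => //.
    by move=> x _; exact: ltry.
  by move=> x /andP[x0 /(lt_trans x0)]; rewrite ltxx.
apply/eqP; rewrite eq_le; apply/andP; split.
  apply/lee_addgt0Pr => e e0; rewrite -EFinD.
  have [ie|ei] := leP i e.
    by apply: le_trans (limsup_growth_le1 s) _; rewrite lee_fin; lra.
  have /gti/finite_upper_solutions_gt fin : 0 < i - e < i by apply/andP; split; lra.
  have nu1 : 1 <= (i - e)^-1.
    by rewrite -lee_fin; apply: le_trans mu1 _; apply/ltW/gti; apply/andP; split; lra.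
  by apply: le_trans (limsup_growth_le nu1 fin) _; rewrite invrK lee_fin; lra.
apply/lee_subgt0Pr => e e0; rewrite -EFinB.
have [ie|ie] := leP 1 (i + e).
  by apply: le_trans (limsup_growth_ge (lexx 1) inf1); rewrite invr1 lee_fin; lra.
have ie0 : 0 < i + e by lra.
have /lti/infinite_upper_solutions_lt[nu nugt inf] : i < i + e by lra.
have nu1 : 1 <= nu.
  by apply: le_trans (ltW nugt); rewrite invf_ge1// ltW.
apply: le_trans (limsup_growth_ge nu1 inf); rewrite lee_fin.
have nu0 : 0 < nu by exact: lt_le_trans nu1.
have : nu^-1 < i + e by rewrite invf_plt.
by lra.
Qed.

End UpperExponent.

Theorem proposition3p3 (R : realType) (s : R) (hs : ~ rational s) :
  limf_esup (fun t : R => (ln (alpha1 (act (h t) (Lambda s))) / ln t)%:E) +oo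
    = (1 - 1 / mu_plus s)%E
  /\
  limf_esup (fun t : R => (ln (alpha1 (act (h (- t)) (Lambda s))) / ln t)%:E) +oo
    = (1 - 1 / mu_minus s)%E.
Proof.
split; first exact: limsup_growthE.
under eq_fun do rewrite alpha1_reflect.
by rewrite mu_minusE limsup_growthE//; exact: irrational_opp.
Qed.
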